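(* Let $G$ be a finite $p$-solvable group and $P$ a Sylow $p$-subgroup of $G$. (1) If $p>2$, then $\ell_p(G)\le \lceil \operatorname{pwc}(P)/(p-2)\rceil$. (2) If $p=2$, then $\ell_2(G)\le \operatorname{pwc}(P)$.
   Context: For a finite $p$-group $P$, a normal subgroup $N$ of $P$ is powerfully embedded in $P$ if $[N,P]\le N^p$ when $p$ is odd, and $[N,P]\le N^4$ when $p=2$ (here $N^{k}$ denotes the subgroup generated by all $k$-th powers of elements of $N$). An $\eta$-series of $P$ is an ascending series $1=N_0\le N_1\le N_2\le\cdots$ of normal subgroups of $P$ such that $N_{i+1}/N_i$ is powerfully embedded in $P/N_i$ for all $i$. For $N\trianglelefteq P$, the powerful height $\operatorname{pwh}_P(N)$ is the smallest $k$ such that there is an $\eta$-series with $N_k=N$. The powerful class of $P$ is $\operatorname{pwc}(P)=\operatorname{pwh}_P(P)$. $\ell_p(G)$ denotes the $p$-length of the $p$-solvable group $G$. *)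

(* Defs.v *)
From mathcomp Require Import all_boot all_order all_fingroup all_solvable.
Set Implicit Arguments. Unset Strict Implicit. Unset Printing Implicit Defensive.
Import GroupScope.
Local Open Scope group_scope.

Section Defs.
Variable gT : finGroupType.

Definition pow_subgroup (N : {set gT}) (k : nat) : {set gT} :=
  <<[set x ^+ k | x in N]>>.

Definition pw_embedded (p : nat) (N P : {set gT}) : bool :=
  (N <| P) && ([~: N, P] \subset pow_subgroup N (if p == 2 then 4 else p)).

Definition p_solvable (p : nat) (G : {set gT}) : Prop :=
  exists s : seq {group gT},
    path (fun H K : {group gT} => (H <| K) && (p.-group (K / H) || p^'.-group (K / H)))
         1%G s
    && (last 1%G s == G :> {set gT}).
End Defs.

Definition eta_series (gT : finGroupType) (p : nat) (P : {set gT})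
  (s : seq {group gT}) : bool :=
  path (fun A B : {group gT} =>
          [&& A \subset B, B <| P & pw_embedded p (B / A) (P / A)]) 1%G s.

Definition eta_reaches (gT : finGroupType) (p : nat) (P N : {set gT}) (k : nat) : bool :=
  [exists s : k.-tuple {group gT}, eta_series p P s && (last 1%G s == N :> {set gT})].

(* powerful height: the least k with an eta-series having N_k = N
   (such k always exists, and is <= #|P|, for N normal in a finite p-group P) *)
Definition pwh (gT : finGroupType) (p : nat) (P N : {set gT}) : nat :=
  find (eta_reaches p P N) (iota 0 #|P|.+1).

Definition pwc (gT : finGroupType) (p : nat) (P : {set gT}) : nat := pwh p P P.

Definition pseq (p : nat) (n : nat) : seq nat_pred :=
  p^' :: flatten (nseq n [:: (p : nat_pred); p^']).

(* p-length: the least n such that O_{p',p,...,p,p'}(G) (n copies of p) is G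
   (exists and is <= #|G| for p-solvable G) *)
Definition p_length (gT : finGroupType) (p : nat) (G : {set gT}) : nat :=
  find (fun n => pseries (pseq p n) G == G) (iota 0 #|G|.+1).

(* Main.v *)
(** As for Hall and Higman, the core is a bound on the minimal polynomial of a [p]-element: if [x] of
    order [p] normalises a [p']-group [K] and [(x - 1)^(p-2) = 0] on a [p]-group [U] acted on by [K]
    and [x], then [[K, x]] centralises [U].  No representation theory of extraspecial groups is
    needed.  On an irreducible module the sums [b_i] of the [K]-conjugates of [x^-i] are central; they
    cannot all vanish for [1 <= i <= p-2], since averaging [(1 - x^-1)^(p-2) = 0] over [K] would
    give [#|K| = 0].  If [b_i <> 0] and [y = x^i], then [y b_i] is a scalar plus a trace
    [\sum_j y^j f y^-j], and such a trace lies in the right ideal generated by [(y - 1)^2].  Hence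
    [y - 1] lies in it too, and being nilpotent it vanishes.

    In a [p]-solvable [G] with [O_p'(G) = 1] and [Q = O_p(G)], one shows by induction along an
    eta-series that its first [p - 2] terms ([1] if [p = 2]) lie in [Q].  If a term [N] does not, let
    [T] be the last of its iterated power subgroups not inside [Q].  Take [K] a complement to [Q] in
    [O_{p,p'}(G)] and [U = Q / C_Q(K)Phi(Q)]: on [U], a [p]-th power of an element of [T] is an
    iterated commutator of length [p - 1], because modulo [Q] that element normalises [K].  Combined
    with the eta-condition on [T] this forces [T] to act on [U] with [(x - 1)^(p-2) = 0], so [T]
    centralises [O_p'(G / Q)] and lies in [Q].  Factoring out [O_{p',p}(G)] thus costs one unit of
    [p]-length and [p - 2] steps of the series. *)
Require Import Defs.
From mathcomp Require Import all_boot all_order all_fingroup all_solvable.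
From mathcomp Require Import all_algebra all_character.
Set Implicit Arguments. Unset Strict Implicit. Unset Printing Implicit Defensive.
Import GroupScope GRing.Theory.

(** * Minimal polynomials of p-elements *)
(** Every orbit of [f] on [S] has length [p], because its length divides [p] and is not 1; [S']
    takes the root of each orbit. This turns a sum permuted by an element of order [p] into a
    trace. *)
Lemma big_free_orbits (T : finType) (R : nmodType) (f : T -> T) (p : nat)
    (S : {set T}) (F : T -> R) :
    prime p -> injective f ->
    {in S, forall x, [/\ f x \in S, f x != x & iter p f x = x]} ->
  exists2 S' : {set T}, S' \subset S &
    (\sum_(x in S) F x = \sum_(i < p) \sum_(x in S') F (iter i f x))%R.
Proof.
move=> p_pr f_inj freeS.
have closedS: fclosed f S.
  apply: (intro_closed (fconnect_sym f_inj)) => x y /eqP <- /freeS[] //.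
have ordS x : x \in S -> fingraph.order f x = p.
  case/freeS=> _ fx' fpx; set o := fingraph.order f x.
  have o_p: o %| p.
    (* Removing full periods from [iter p f x = x] leaves [p %% o] iterations fixing [x]; as this is
       less than [o], it is 0. *)
    have lt_po: p %% o < o by rewrite ltn_mod fingraph.order_gt0.
    rewrite /dvdn -(findex_iter lt_po) findex_eq0 -{1}fpx {1}(divn_eq p o) addnC iterD.
    apply/eqP; congr (iter _ _ _); elim: (p %/ o) => // k IH.
    by rewrite mulSn addnC iterD (iter_order f_inj).
  have [_ /(_ _ o_p)/orP[/eqP o1|/eqP//]] := primeP p_pr.
  by have := iter_order f_inj x; rewrite -/o o1 /= => /eqP; rewrite (negPf fx').
exists [set x in S | froot f x == x]; first by apply/subsetP=> x /setIdP[].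
rewrite (partition_big (froot f) (fun x => (x \in S) && (froot f x == x))) /=; last first.
  move=> x Sx; rewrite -(closed_connect closedS (connect_root _ x)) Sx.
  by rewrite (root_root (fconnect_sym f_inj)) eqxx.
rewrite [RHS]exchange_big /=; apply: eq_big => [x|x /andP[Sx /eqP rx]]; first by rewrite inE.
rewrite (eq_bigl (mem (fingraph.orbit f x))) => [|y]; last first.
  rewrite [RHS]inE /= -fconnect_orbit -(root_connect (fconnect_sym f_inj)) rx [RHS]eq_sym.
  apply: andb_idl => /eqP fy; rewrite -(closed_connect closedS (x := x)) //.
  by rewrite -(root_connect (fconnect_sym f_inj)) rx fy.
rewrite -big_uniq ?orbit_uniq //= (big_nth x) size_orbit ordS // big_mkord.
by apply: eq_bigr => i _; rewrite nth_traject // ordS.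
Qed.

(** * Sums of powers in characteristic p *)

Section PowerSums.
Local Open Scope ring_scope.

(** Multiplied by ['X - 1], both sides become ['X^p - 1], by the Frobenius map. *)
Lemma sum_expr_pchar (F : fieldType) (p : nat) :
  p \in [pchar F] -> \sum_(i < p) 'X^i = ('X - 1) ^+ p.-1 :> {poly F}.
Proof.
move=> pF; have p_gt0 := prime_gt0 (pcharf_prime pF).
have pP: p \in [pchar {poly F}] by rewrite pchar_poly.
have nz: 'X - 1 != 0 :> {poly F} by rewrite polyXsubC_eq0.
apply: (mulfI nz); rewrite -subrX1 -exprS prednK //.
by rewrite -!(pFrobenius_autE pP) rmorphB rmorph1.
Qed.

Lemma sum_expr_mx (F : fieldType) (p n : nat) (z : 'M[F]_n.+1) :
  p \in [pchar F] -> \sum_(i < p) z ^+ i = (z - 1) ^+ p.-1.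
Proof.
move=> pF; have /(congr1 (horner_mx z)) := sum_expr_pchar pF.
rewrite rmorph_sum rmorphXn rmorphB rmorph1 /= horner_mx_X => <-.
by apply: eq_bigr => i _; rewrite rmorphXn /= horner_mx_X.
Qed.

(** Differentiate [sum_expr_pchar], multiply by ['X] and evaluate at [z]. *)
Lemma sum_mulrn_expr_mx (F : fieldType) (p n : nat) (z : 'M[F]_n.+1) :
    p \in [pchar F] ->
  \sum_(i < p) z ^+ i *+ i = z * (z - 1) ^+ p.-2 *+ p.-1.
Proof.
move=> pF; have /(congr1 deriv) := sum_expr_pchar pF.
move/(congr1 (fun q => horner_mx z ('X * q))).
rewrite raddf_sum /= deriv_exp derivB derivX derivC subr0 mul1r.
rewrite mulr_sumr rmorph_sum -mulrnAr rmorphM rmorphMn rmorphXn rmorphB rmorph1 /= horner_mx_X.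
rewrite mulrnAr => <-.
apply: eq_bigr => i _; rewrite derivXn mulrnAr rmorphMn /= -exprS rmorphXn /= horner_mx_X.
(* At [i = 0] the truncated exponent [i.-1] is harmless: the coefficient is 0. *)
by case: i => -[].
Qed.

Lemma expr_mod_sq (R : nzRingType) (y : R) (i : nat) :
  exists r, y ^+ i = 1 + (y - 1) *+ i + (y - 1) ^+ 2 * r.
Proof.
elim: i => [|i [r IH]]; first by exists 0; rewrite mulr0 !addr0.
exists (r * y + i%:R); rewrite exprSr IH; set u := y - 1.
have yE : (1 + u *+ i) * y = 1 + u *+ i.+1 + u ^+ 2 * i%:R.
  rewrite -[X in _ * X](subrK 1 y) -/u mulrDr mulr1 mulrDl mul1r mulrnAl -expr2.
  by rewrite mulr_natr mulrS addrACA [u + 1]addrC [_ + u *+ i]addrC addrA -(addrA 1).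
by rewrite mulrDl yE -mulrA -addrA -mulrDr [i%:R + _]addrC.
Qed.

(** Expand [y ^+ i] to second order in [u = y - 1]. Up to the right ideal generated by [u ^+ 2], the
    trace is [f] times the sum of the [z ^+ i] plus [u * f] times the sum of the [z ^+ i *+ i]. Both
    sums have a factor [(z - 1) ^+ p.-2], which vanishes since [z - 1 = - (u * z)]. *)
Lemma trace_conj_sq (F : fieldType) (p n : nat) (y z f : 'M[F]_n.+1) :
    p \in [pchar F] -> y * z = 1 -> z * y = 1 -> (y - 1) ^+ p.-2 = 0 ->
  exists g, \sum_(i < p) y ^+ i * f * z ^+ i = (y - 1) ^+ 2 * g.
Proof.
move=> pF yz zy nil_y; set u := y - 1.
have uz : GRing.comm u z by rewrite /GRing.comm mulrBl mulrBr yz zy mulr1 mul1r.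
have z1: z - 1 = - (u * z) by rewrite mulrBl yz mul1r opprB.
have nil_z: (z - 1) ^+ p.-2 = 0.
  by rewrite z1 exprNn exprMn_comm // nil_y mul0r mulr0.
have S1: \sum_(i < p) z ^+ i *+ i = 0 by rewrite sum_mulrn_expr_mx // nil_z mulr0 mul0rn.
have S0: \sum_(i < p) z ^+ i = 0.
  rewrite sum_expr_mx //; case: (p) (pcharf_prime pF) nil_z => [|[|q]] //= _ nil_z.
  by rewrite exprS nil_z mulr0.
have sum_pow k : exists g, \sum_(i < k) y ^+ i * f * z ^+ i
    = f * (\sum_(i < k) z ^+ i) + u * f * (\sum_(i < k) z ^+ i *+ i) + u ^+ 2 * g.
  elim: k => [|k [g IH]]; first by exists 0; rewrite !big_ord0 !mulr0 !addr0.
  have [r yk] := expr_mod_sq y k; exists (g + r * f * z ^+ k).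
  rewrite -/u in yk; rewrite !big_ord_recr /= IH yk; clearbody u; rewrite !mulrDl !mulrDr mul1r !mulrA !mulrnAl mulrnAr.
  by rewrite addrACA; congr (_ + _); exact: addrACA.
by have [g ->] := sum_pow p; exists g; rewrite S0 S1 !mulr0 !add0r.
Qed.
End PowerSums.

Lemma iterJ (gT : finGroupType) (y g : gT) (j : nat) :
  iter j (fun h => h ^ y^-1)%g g = (g ^ (y ^- j))%g.
Proof. by elim: j => [|j IH]; rewrite ?invg1 ?conjg1 // iterS IH -conjgM expgS invMg. Qed.

(** * Irreducible modules *)

Section HallHigmanIrr.
Local Open Scope ring_scope.

Lemma irr_quadratic_trivial (F : fieldType) (p : nat) (gT : finGroupType)
    (G K : {group gT}) (x : gT) (n : nat) (rG : mx_representation F G n.+1) :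
    p \in [pchar F] -> mx_irreducible rG -> G :=: (K <*> <[x]>)%g ->
    x \in 'N(K) -> (p^').-group K -> (x ^+ p = 1)%g ->
    (rG x - 1) ^+ p.-2 = 0 ->
  rG x = 1.
Proof.
move=> pF irrG defG nKx p'K xp nil_x; have p_pr := pcharf_prime pF.
have sKG: K \subset G by rewrite defG joing_subl.
have Gx: x \in G by rewrite defG mem_gen // inE cycle_id orbT.
have GK g : g \in K -> g \in G by apply/subsetP.
have Gxi i : (x ^+ i)%g \in G by rewrite groupX.
have nKxi i : (x ^+ i)%g \in 'N(K) by rewrite groupX.
have rGM g h : g \in G -> h \in G -> rG (g * h)%g = rG g * rG h by exact: repr_mxM.
have rGX g i : g \in G -> rG (g ^+ i)%g = rG g ^+ i.
  by move=> Gg; elim: i => [|i IH]; rewrite ?repr_mx1 // expgS exprS rGM ?groupX // IH.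
have GJ g i : g \in K -> (g * x ^- i * g^-1)%g \in G.
  by move=> /GK Gg; rewrite !groupM ?groupV.
(* Reindexing by left multiplication shows that [b i] commutes with [K]; reindexing by conjugation
   by [x^-1], which preserves [K], shows that it commutes with [x]. *)
pose b i := \sum_(g in K) rG (g * x ^- i * g^-1)%g.
have cGb i : centgmx rG (b i).
  suff: (K <*> <[x]>)%g \subset rcent rG (b i) by rewrite -defG.
  rewrite join_subG cycle_subG; apply/andP; split.
    apply/subsetP=> h Kh; rewrite inE GK //=; apply/eqP.
    rewrite mulmx_suml mulmx_sumr (reindex_inj (mulgI h)) /=.
    apply: eq_big => [g|g]; rewrite groupMl // => Kg.
    rewrite -[LHS]repr_mxM -?[RHS]repr_mxM ?GJ ?GK ?groupM //.
    by congr (rG _); rewrite invMg !mulgA mulgKV.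
  rewrite inE Gx /=; apply/eqP.
  rewrite mulmx_suml mulmx_sumr (reindex_inj (conjg_inj x^-1%g)) /=.
  have KJ g : ((g ^ x^-1)%g \in K) = (g \in K) by rewrite memJ_norm ?groupV.
  apply: eq_big => [g|g]; rewrite KJ // => Kg.
  rewrite -[LHS]repr_mxM -?[RHS]repr_mxM ?GJ ?KJ //.
  congr (rG _); rewrite -[RHS](mulgKV x); congr (_ * _)%g.
  have -> : (x * (g * x ^- i * g^-1) * x^-1 = (g * x ^- i * g^-1) ^ x^-1)%g.
    by rewrite conjgE invgK -[LHS]mulgA.
  rewrite !conjMg !conjVg; congr (_ * _ * _)%g.
  by rewrite conjXg conjgE invgK mulgV mulg1.
have unitP A : centgmx rG A -> A = 0 \/ A \is a GRing.unit.
  by move=> cA; have [->|nz] := eqVneq A 0; [left | right; apply: mx_Schur irrG _ cA nz].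
have nK : (#|K|%:R : 'M[F]_n.+1) != 0.
  rewrite -scaler_nat scaler_eq0 oner_eq0 orbF.
  by rewrite -(dvdn_pcharf pF) -p'natE.
(* The indices [0 < i < p - 1] are the exponents of the nonconstant terms of [(1 - z) ^+ p.-2],
   expanded in the second case. They are prime to [p], so [x ^+ i] generates [<[x]>]. *)
case: (pickP (fun i : 'I_p.-1 => (0 < i)%N && (b i != 0))) => [i /andP[i_gt0 nz_b]|b0].
  pose y0 := (x ^+ i)%g; pose y := rG y0; pose z := rG y0^-1%g; pose u := y - 1.
  have Gy : y0 \in G by exact: Gxi.
  have yz : y * z = 1 by rewrite -rGM ?groupV // mulgV repr_mx1.
  have zy : z * y = 1 by rewrite -rGM ?groupV // mulVg repr_mx1.
  have nil_u : u ^+ p.-2 = 0.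
    rewrite /u /y rGX // subrX1 exprMn_comm ?nil_x ?mul0r //.
    apply: commr_sum => j _; apply: commrX; apply: commr_sym.
    by apply: commrB; [apply: commr_refl | apply: commr1].
  suffices y1 : y = 1.
    have: x \in rker rG.
      have : (<[x]> \subset rker rG)%g.
        have /eqP-> : generator <[x]>%g y0.
          rewrite generator_coprime; apply: (@coprime_dvdl _ p); first by rewrite order_dvdn xp.
          by rewrite prime_coprime // gtnNdvd // (leq_trans (ltn_ord i)) // leq_pred.
        by rewrite cycle_subG inE Gy mul1mx; apply/eqP.
      by rewrite cycle_subG.
    by rewrite inE Gx mul1mx => /eqP.
  have unit_b : b i \is a GRing.unit.
    by case: (unitP _ (cGb i)) nz_b => // ->; rewrite eqxx.
  pose s g := rG (y0 * g * y0^-1 * g^-1)%g.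
  have [S' sS'S sumS'] : exists2 S' : {set gT}, S' \subset K :\: 'C[y0] &
      \sum_(g in K :\: 'C[y0]) s g
        = \sum_(j < p) \sum_(g in S') s (iter j (fun g => g ^ y0^-1)%g g).
    apply: big_free_orbits => // [|g]; first exact: conjg_inj.
    rewrite in_setD => /andP[ncg Kg]; split.
    - by rewrite in_setD !memJ_norm ?ncg ?groupV ?nKxi // (subsetP (normG _)) ?cent1id.
    - apply: contra ncg => /eqP/conjg_fixP/commgP /commuteV; rewrite invgK => cgy.
      exact/cent1P/commute_sym.
    by rewrite iterJ -expgM mulnC expgM xp expg1n invg1 conjg1.
  have sJ j g : g \in K -> s (g ^ (y0 ^- j))%g = y ^+ j * s g * z ^+ j.
    move=> Kg; have yJ: (y0 ^ (y0 ^- j) = y0)%g.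
      by rewrite conjgE invgK mulgA -expgSr expgS mulgK.
    have -> : s (g ^ (y0 ^- j))%g = rG ((y0 * g * y0^-1 * g^-1) ^ (y0 ^- j))%g.
      by rewrite /s !conjMg !conjVg yJ.
    rewrite /s conjgE invgK -(expgVn y0 j) mulgA.
    have Gs : (y0 * g * y0^-1 * g^-1)%g \in G by rewrite !groupM ?groupV // GK.
    move: (y0 * g * y0^-1 * g^-1)%g Gs => a Ga.
    by rewrite rGM ?(rGM _ a) ?groupM ?groupX ?groupV // (rGX y0) ?(rGX y0^-1%g) ?groupV.
  (* conjugation by [y] permutes the terms of [y * b i]: trivially over ['C_K[y]], freely elsewhere *)
  have [g0 eq_yb] : exists g0, y * b i = #|(K :&: 'C[y0])%g|%:R + u ^+ 2 * g0.
    have [g0 eq_g0] := trace_conj_sq (\sum_(g in S') s g) pF yz zy nil_u.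
    exists g0; rewrite -eq_g0 mulr_sumr.
    transitivity (\sum_(g in K) s g).
      by apply: eq_bigr => g Kg; rewrite -rGM ?GJ // /s !mulgA.
    rewrite (big_setID 'C[y0]) /= sumS'; congr (_ + _).
      rewrite -sumr_const; apply: eq_bigr => g /setIP[Kg /cent1P cgy].
      by rewrite /s -cgy mulgK mulgV repr_mx1.
    apply: eq_bigr => j _; rewrite mulr_sumr mulr_suml; apply: eq_bigr => g S'g.
    by rewrite iterJ sJ //; case/setDP: (subsetP sS'S _ S'g).
  set c : 'M_n.+1 := _%:R in eq_yb.
  have bE : b i - c = u * (u * g0 - b i).
    rewrite mulrBr mulrA -expr2; apply/eqP.
    rewrite subr_eq -addrA [- _ + c]addrC addrA [_ + c]addrC -eq_yb -mulrBl.
    by rewrite /u opprB addrC subrK mul1r.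
  have cd : centgmx rG (b i - c).
    apply/centgmxP=> g Gg; rewrite mulmxBl mulmxBr (centgmxP (cGb i)) //.
    by congr (_ - _); rewrite /c -[_%:R]scaler_nat -scalemxAl -scalemxAr mulmx1 mul1mx.
  (* By Schur the difference is zero or invertible; in the latter case [bE] would give the nilpotent
     [u] a right inverse. *)
  have [/subr0_eq bc|unit_d] := unitP _ cd; last first.
    have unit_u: u \is a GRing.unit.
      have [|uu _] := @mulmx1_unit _ _ u ((u * g0 - b i) * (b i - c)^-1); last exact: uu.
      by rewrite [LHS]mulrA -bE divrr.
    by move/(unitrX p.-2): unit_u; rewrite nil_u unitr0.
  (* Now [u * b i = u ^+ 2 * g0] with [b i] invertible, and iterating puts [u] in the right ideal of
     every power of [u]. *)
  have uw : u = u ^+ 2 * (g0 / b i).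
    move/eqP: bE; rewrite bc subrr eq_sym mulrBr subr_eq0 -bc => /eqP ub.
    by rewrite expr2 -mulrA [u * (g0 / _)]mulrA mulrA ub mulrK.
  have uk k : u = u ^+ k.+1 * (g0 / b i) ^+ k.
    elim: k => [|k IH]; first by rewrite expr1 expr0 mulr1.
    rewrite [(g0 / _) ^+ _]exprS mulrA -addn2 exprD -(mulrA (u ^+ k)) -uw -exprSr.
    exact: IH.
  by apply/eqP; rewrite -subr_eq0 -/u (uk p.-2) exprS nil_u mulr0 mul0r.
pose z := rG x^-1%g.
have xz : rG x * z = 1 by rewrite -rGM ?groupV // mulgV repr_mx1.
have zx : z * rG x = 1 by rewrite -rGM ?groupV // mulVg repr_mx1.
have nil_z: (1 - z) ^+ p.-2 = 0.
  have -> : 1 - z = (rG x - 1) * z by rewrite mulrBl mul1r xz.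
  rewrite exprMn_comm ?nil_x ?mul0r //.
  by rewrite /GRing.comm mulrBl mulrBr mulr1 mul1r xz zx.
(* Sum the [K]-conjugates of the zero matrix [(1 - z) ^+ p.-2]: its constant term contributes
   [#|K|], every other term a multiple of some [b i = 0]. *)
case/eqP: nK; rewrite -sumr_const.
transitivity (\sum_(g in K) rG g * (1 - z) ^+ p.-2 * rG g^-1%g); last first.
  by rewrite big1 // => g _; rewrite nil_z mulr0 mul0r.
rewrite exprBn_comm; last exact: commr_sym (commr1 _).
under [RHS]eq_bigr do rewrite mulr_sumr mulr_suml.
rewrite exchange_big big_ord_recl /= [X in _ = _ + X]big1 ?addr0 => [|i _].
  apply: eq_bigr => g Kg; rewrite expr1n !expr0 !mulr1 bin0 mulr1n.
  by rewrite mulr1 -rGM ?groupV ?GK // mulgV repr_mx1.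
have lti: (lift ord0 i < p.-1)%N by rewrite lift0 -ltn_predRL.
have /negbT := b0 (Ordinal lti); rewrite /= negbK => /eqP b0i.
transitivity ((-1) ^+ lift ord0 i * b (lift ord0 i) *+ 'C(p.-2, lift ord0 i)).
  2: by rewrite b0i mulr0 mul0rn.
rewrite mulr_sumr -sumrMnl; apply: eq_bigr => g Kg.
have Gg := GK g Kg; rewrite mulrnAr mulrnAl expr1n mulr1 !rGM ?groupM ?groupV //.
rewrite !mulrA -[rG g * _ * z ^+ _]mulrA; congr (_ *+ _).
rewrite -expgVn rGX ?groupV // -/z !mulrA; congr (_ * _ * _).
exact: commr_sign.
Qed.
End HallHigmanIrr.

(** * Iterated commutators and coprime action *)
(** The left-normed commutator [[W, Y, ..., Y]] with [n] entries [Y]. On an abelian section it is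
    the group form of applying [n] operators [y - 1]. *)
Definition iter_comm (gT : finGroupType) (Y : {set gT}) (n : nat) (W : {set gT}) : {set gT} :=
  iter n (fun V => [~: V, Y]) W.

Section IterComm.
Variable gT : finGroupType.
Implicit Types (Y Z V W : {set gT}).

Lemma iter_commS n Y Z V W :
  Y \subset Z -> V \subset W -> iter_comm Y n V \subset iter_comm Z n W.
Proof. by move=> sYZ sVW; elim: n => //= n IH; apply: commgSS. Qed.

Lemma iter_commSr n Y W : iter_comm Y n.+1 W = iter_comm Y n [~: W, Y].
Proof. exact: iterSr. Qed.

Lemma iter_commD m n Y W : iter_comm Y (m + n) W = iter_comm Y m (iter_comm Y n W).
Proof. exact: iterD. Qed.

Lemma iter_comm_group n (Y W : {group gT}) : group_set (iter_comm Y n W).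
Proof. by case: n => [|n]; apply: groupP. Qed.
Canonical iter_comm_gp n (Y W : {group gT}) := Group (iter_comm_group n Y W).

Lemma iter_comm_norm n (Y Z W : {group gT}) :
  Z \subset 'N(Y) -> Z \subset 'N(W) -> Z \subset 'N(iter_comm Y n W).
Proof. by move=> nYZ nWZ; elim: n => //= n IH; apply: normsR. Qed.

Lemma iter_comm_sub n (Y W : {group gT}) : Y \subset 'N(W) -> iter_comm Y n W \subset W.
Proof.
move=> nWY; elim: n => //= n; apply: subset_trans.
by rewrite commg_subl (iter_comm_norm n (normG Y) nWY).
Qed.

Lemma quotient_iter_comm n (Y W H : {group gT}) :
    Y \subset 'N(H) -> W \subset 'N(H) -> Y \subset 'N(W) ->
  iter_comm Y n W / H = iter_comm (Y / H) n (W / H).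
Proof.
move=> nHY nHW nWY; elim: n => //= n IH.
by rewrite quotientR ?IH // (subset_trans (iter_comm_sub n nWY)).
Qed.

(** The inclusion of [W] in [Y] makes the second factor normalise the commutators of the first, so
    that commutators distribute over the product. *)
Lemma iter_comm_mul n (Y V W : {group gT}) :
    Y \subset 'N(V) -> Y \subset 'N(W) -> W \subset Y ->
  iter_comm Y n (V * W) \subset iter_comm Y n V * iter_comm Y n W.
Proof.
move=> nVY nWY sWY; elim: n => //= n IH; apply: subset_trans (commSg Y IH) _.
rewrite commMG // normsR ?(subset_trans _ (iter_comm_norm n (normG Y) nVY)) //.
  by rewrite (subset_trans (iter_comm_sub n nWY)).
by rewrite (subset_trans (iter_comm_sub n nWY)) // (subset_trans sWY) ?normG.
Qed.
End IterComm.

(** Written additively, the commutator of [v] with [x] is [v (x - 1)]; this translates nilpotency of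
    [x - 1] into vanishing commutators. *)
Lemma rVabelem_iter_comm (gT : finGroupType) (p : nat) (G E : {group gT})
    (abelE : p.-abelem E) (ntE : E :!=: 1) (nEG : G \subset 'N(E))
    (x : gT) (k : nat) v :
    x \in G ->
  rVabelem abelE ntE (v *m (abelem_repr abelE ntE nEG x - 1) ^+ k)%R
    \in iter_comm <[x]> k E.
Proof.
move=> Gx; elim: k v => [|k IH] v; first by rewrite GRing.expr0 mulmx1 mem_rVabelem.
rewrite GRing.exprSr [(_ ^+ k * _)%R]/(_ *m _)%R mulmxA; set w := (v *m _)%R.
have Ew : rVabelem abelE ntE w \in E := mem_rVabelem _ _ _.
rewrite mulmxBr mulmx1 rVabelemD rVabelemN rVabelemJ //.
rewrite -(centsP (abelem_abelian abelE) _ (groupVr Ew)); last first.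
  by rewrite memJ_norm ?(subsetP nEG).
by rewrite -commgEl /= mem_commg ?cycle_id ?IH.
Qed.

(** By coprimeness the fixed points of [A] on [G / H] lift to fixed points in [G]. So ['C_G(A)]
    covers [G / H], and it contains [H]. *)
Lemma coprime_cent_stable (gT : finGroupType) (A G H : {group gT}) :
    H <| G -> A \subset 'C(H) -> A \subset 'N(G) -> [~: G, A] \subset H ->
    coprime #|G| #|A| -> solvable G ->
  A \subset 'C(G).
Proof.
move=> /andP[sHG nHG] cHA nGA sGAH coGA solG.
have nHA : A \subset 'N(H) by apply: cents_norm.
rewrite centsC; apply/setIidPl/eqP.
rewrite eqEsubset subsetIl -(quotientSGK nHG) ?subsetI ?sHG; last by rewrite centsC.
rewrite coprime_quotient_cent // subsetI subxx.
by rewrite quotient_cents2.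
Qed.

(** Lifting fixed points, ['C_P(A)] and ['Phi(P)] generate [P], and ['Phi(P)] consists of
    non-generators. *)
Lemma coprime_cent_Phi (gT : finGroupType) (p : nat) (A P : {group gT}) :
    p.-group P -> A \subset 'N(P) -> coprime #|P| #|A| -> [~: P, A] \subset 'Phi(P) ->
  A \subset 'C(P).
Proof.
move=> pP nPA coPA sPA; have [sFP nFP] := andP (Phi_normal P).
have nFA : A \subset 'N('Phi(P)) := char_norm_trans (Phi_char P) nPA.
rewrite centsC; apply/setIidPl; rewrite -[RHS](@Phi_nongen _ P 'C_P(A)) ?genGid //.
apply/eqP; rewrite eqEsubset join_subG sFP subsetIl /=.
rewrite -(quotientSGK nFP) ?joing_subl //.
rewrite quotientYidl ?(subset_trans (subsetIl _ _)) // coprime_quotient_cent ?(pgroup_sol pP) //.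
by rewrite subsetI subxx quotient_cents2.
Qed.

(** Induction on [#|U|]. A minimal normal subgroup [E] of [K <*> <[x]>] inside ['Z(U)] is an
    irreducible module, so [x] centralises it, and so does [[~: K, <[x]>]]. That commutator
    centralises [U / E] by induction, hence [U] by coprimeness. *)
Lemma quadratic_comm_cent (p : nat) (gT : finGroupType) (U K : {group gT}) (x : gT) :
    prime p -> p.-group U -> p^'.-group K -> x \in 'N(K) -> x \in 'N(U) ->
    K \subset 'N(U) -> x ^+ p = 1 -> iter_comm <[x]> p.-2 U = 1 ->
  [~: K, <[x]>] \subset 'C(U).
Proof.
move=> p_pr; have [m] := ubnP #|U|; elim: m => // m IHm in gT U K x *.
move=> /ltnSE-leUm pU p'K nKx nUx nUK xp Ux1.
have [->|ntU] := eqsVneq U 1; first by rewrite cents1.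
pose G := K <*> <[x]>.
have nUG : G \subset 'N(U) by rewrite join_subG nUK cycle_subG.
have ntZ : 'Z(U) != 1 by rewrite center_nil_eq1 ?(pgroup_nil pU).
have [E minE sEZ] := minnormal_exists ntZ (char_norm_trans (center_char U) nUG).
have sEU : E \subset U := subset_trans sEZ (center_sub U).
have solE : solvable E := solvableS sEU (pgroup_sol pU).
have [nEG ntE abelE] := minnormal_solvable minE (subxx _) solE.
rewrite (is_abelem_pgroup (pgroupS sEU pU)) in abelE.
have Gx : x \in G by rewrite mem_gen // inE cycle_id orbT.
have sKG : K \subset G by rewrite joing_subl.
have nEU : U \subset 'N(E) by rewrite cents_norm // centsC (subset_trans sEZ) ?subsetIr.
have nEx : x \in 'N(E) by rewrite (subsetP nEG).
have nEK := subset_trans sKG nEG.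
have cEx : x \in 'C_G(E).
  rewrite -(rker_abelem abelE ntE nEG) inE Gx /= mul1mx; apply/eqP.
  apply: (irr_quadratic_trivial (p := p) (K := K)) => //.
  - by rewrite inE p_pr pchar_Fp_0.
  - exact/abelem_mx_irrP.
  apply/row_matrixP=> i; rewrite rowE row0; apply: (rVabelem_inj abelE ntE).
  rewrite rVabelem0; apply/set1P; rewrite -[[set 1]]Ux1.
  exact: subsetP (iter_commS _ (subxx _) sEU) _ (rVabelem_iter_comm _ _ _ _ _ Gx).
have sAK : [~: K, <[x]>] \subset K by rewrite commg_subl cycle_subG.
have cAE : [~: K, <[x]>] \subset 'C(E).
  have cxE : <[x]> \subset 'C_G(E) by rewrite cycle_subG.
  apply: subset_trans (commgSS sKG cxE) _.
  apply: subset_trans (subsetIr G _).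
  by rewrite commg_subr normsI ?normG ?norms_cent.
have sAE : [~: K, <[x]>] / E \subset 'C(U / E).
  rewrite quotientR ?cycle_subG // quotient_cycle //.
  apply: IHm; rewrite ?quotient_pgroup ?mem_quotient ?quotient_norms //.
  - by apply: leq_trans leUm; apply: ltn_quotient.
  - by rewrite -cycle_subG -quotient_cycle // quotient_norms ?cycle_subG.
  - by rewrite -cycle_subG -quotient_cycle // quotient_norms ?cycle_subG.
  - by rewrite -morphX // xp morph1.
  rewrite -quotient_cycle // -quotient_iter_comm ?cycle_subG ?Ux1 ?quotient1 //.
have nUA := subset_trans sAK nUK.
apply: (coprime_cent_stable _ cAE nUA _ _ (pgroup_sol pU)).
- by rewrite /normal sEU.
- by rewrite commGC -quotient_cents2 // (subset_trans sAK).
by apply: pnat_coprime pU _; apply: pgroupS sAK p'K.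
Qed.

(** * p-solvable groups *)
Section PSolvable.
Variable p : nat.

Lemma p_solvable1 (gT : finGroupType) : p_solvable p [1 gT].
Proof. by exists [::]; rewrite /= eqxx. Qed.

Lemma p_solvable_ext (gT : finGroupType) (H K : {group gT}) :
    H <| K -> p.-nat #|K : H| || p^'.-nat #|K : H| ->
  p_solvable p H -> p_solvable p K.
Proof.
move=> nsHK piKH [s /andP[path_s /eqP s_H]]; exists (rcons s K).
rewrite rcons_path last_rcons eqxx path_s /= s_H nsHK /pgroup.
by rewrite card_quotient ?normal_norm // piKH.
Qed.

(** Induction up the series. The first clause is there because a series ends at a group whose
    underlying set is that of [G]. *)
Lemma p_solvable_ind (gT : finGroupType) (Q : {group gT} -> Prop) :
    (forall G H : {group gT}, G :=: H -> Q G -> Q H) -> Q 1%G ->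
    (forall H K : {group gT}, H <| K -> p.-nat #|K : H| || p^'.-nat #|K : H| ->
       Q H -> Q K) ->
  forall G : {group gT}, p_solvable p G -> Q G.
Proof.
move=> Qeq Q1 Qext G [s /andP[path_s /eqP s_G]]; apply: Qeq s_G _.
elim/last_ind: s path_s => [|s K IH] //=.
rewrite rcons_path last_rcons => /andP[path_s /andP[nsHK]].
rewrite /pgroup card_quotient ?normal_norm // => piKH.
exact: Qext nsHK piKH (IH path_s).
Qed.

Lemma p_solvableS (gT : finGroupType) (G C : {group gT}) :
  p_solvable p G -> C \subset G -> p_solvable p C.
Proof.
move=> solG sCG; rewrite -(setIidPr sCG).
elim/p_solvable_ind: {sCG} G / solG => [G H -> //||H K nsHK piKH].
  by rewrite (setIidPl (sub1G C)); apply: p_solvable1.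
have [sHK nHK] := andP nsHK.
apply: (@p_solvable_ext _ (H :&: C)%G (K :&: C)%G).
  by rewrite /normal setSI // normsI // subIset ?nHK ?normG ?orbT.
have dv: #|K :&: C : H :&: C| %| #|K : H|.
  have -> : H :&: C = K :&: C :&: H by rewrite setIAC (setIidPr sHK).
  by rewrite indexgI -!card_quotient ?subIset ?nHK // cardSg ?quotientS ?subsetIl.
by case/orP: piKH => piKH; rewrite (pnat_dvd dv piKH) ?orbT.
Qed.

Lemma quotient_p_solvable (gT : finGroupType) (G N : {group gT}) :
  G \subset 'N(N) -> p_solvable p G -> p_solvable p (G / N).
Proof.
move=> nNG solG; elim/p_solvable_ind: solG nNG => [H K -> //|_|H K nsHK piKH IH nNK].
  by rewrite quotient1; apply: p_solvable1.
have sHK := normal_sub nsHK; have nNH := subset_trans sHK nNK.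
apply: (@p_solvable_ext _ (H / N)%G (K / N)%G) (IH nNH); first exact: quotient_normal.
have dv : #|K / N : H / N| %| #|K : H|.
  by apply: index_quotient; rewrite (setIidPr sHK).
by case/orP: piKH => piKH; rewrite (pnat_dvd dv piKH) ?orbT.
Qed.

(** The first non-trivial term of the series is a p-group or a p'-group, and cores grow along normal
    inclusions. *)
Lemma p_solvable_pcore (gT : finGroupType) (G : {group gT}) :
  p_solvable p G -> G :!=: 1 -> ('O_p(G) != 1) || ('O_p^'(G) != 1).
Proof.
elim/p_solvable_ind => [H K -> //||H K nsHK piKH IH ntK]; first by rewrite eqxx.
have pcoreHK pi : 'O_pi(H) \subset 'O_pi(K).
  by apply: pcore_max (pcore_pgroup _ _) _; apply: char_normal_trans (pcore_char _ _) nsHK.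
have [H1|ntH] := eqsVneq H 1; last first.
  case/orP: (IH ntH) => nt; [apply/orP; left | apply/orP; right]; apply: contraNneq nt => K1.
    by rewrite -subG1 -K1 pcoreHK.
  by rewrite -subG1 -K1 pcoreHK.
rewrite H1 indexg1 in piKH.
by case/orP: piKH => piK; rewrite (pcore_pgroup_id piK) ntK ?orbT.
Qed.

(** The Hall-Higman centraliser lemma, for [p] and [p^'] at once: both cases are needed, for [G] and
    for [G / 'O_p(G)]. If [C] is not inside [O], then [C / O] has a non-trivial [rho]-core. Its
    preimage [L] in [C] splits over [L :&: O]; the complement [B] centralises [O], so it is normal
    in [L] and falls into ['O_rho(G) = 1]. *)
Lemma cent_sub_pcore (gT : finGroupType) (G : {group gT}) (pi rho : nat_pred) :
    (pi, rho) = (p : nat_pred, p^') \/ (pi, rho) = (p^', p : nat_pred) ->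
    p_solvable p G -> 'O_rho(G) = 1 ->
  'C_G('O_pi(G)) \subset 'O_pi(G).
Proof.
move=> defpi solG rho1.
have rhoE : rho =i pi^'.
  by case: defpi => [] [-> ->] // q; rewrite !inE negbK.
pose O := 'O_pi(G)%G; pose C := 'C_G(O)%G; change (C \subset O).
have piO : pi.-group O := pcore_pgroup _ _.
have nsOG : O <| G := pcore_normal _ _; have nOG := normal_norm nsOG.
have nsCG : C <| G by rewrite /normal subsetIl normsI ?normG ?norms_cent.
have sCG := normal_sub nsCG.
have nOC : C \subset 'N(O) := subset_trans sCG nOG.
rewrite -quotient_sub1 // subG1; apply: contraT => ntC.
have nsCGq : C / O <| G / O := quotient_normal _ nsCG.
pose A := 'O_rho(C / O)%G.
have ntA : A :!=: 1.
  have pi1 : 'O_pi(C / O) = 1.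
    apply/trivgP; rewrite /= -(trivg_pcore_quotient pi G).
    apply: pcore_max (pcore_pgroup _ _) _.
    exact: char_normal_trans (pcore_char _ _) nsCGq.
  have := p_solvable_pcore (quotient_p_solvable nOC (p_solvableS solG sCG)) ntC.
  have pi1F : ('O_pi(C / O) != 1) = false by apply/negbTE/negPn/eqP.
  by case: defpi => [[epi erho]|[epi erho]] /=; move: pi1F; rewrite /A /= epi erho => ->; rewrite ?orbF.
have nsAG : A <| G / O by apply: char_normal_trans (pcore_char _ _) nsCGq.
pose L := (C :&: coset O @*^-1 A)%G.
have defA : L / O = A.
  by rewrite quotientIG ?cosetpreK ?(setIidPr (pcore_sub _ _)) // sub_cosetpre.
have nsLG : L <| G.
  by rewrite normalI // -(quotientGK nsOG) cosetpre_normal.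
have sLG := normal_sub nsLG; have sLC : L \subset C := subsetIl _ _.
have nOL := subset_trans sLG nOG.
have cLO : L \subset 'C(O) by rewrite (subset_trans sLC) ?subsetIr.
have piLO : pi.-group (L :&: O) := pgroupS (subsetIr _ _) piO.
have oLO : #|L : L :&: O| = #|A| by rewrite indexgI -card_quotient // defA.
have rhoA : pi^'.-group A by rewrite -(eq_pgroup _ rhoE) pcore_pgroup.
have hallLO : Hall L (L :&: O).
  by rewrite /Hall subsetIl oLO (pnat_coprime piLO).
have nsLO : L :&: O <| L by rewrite /normal subsetIl normsI ?normG.
have [B /complP[tiLB defL]] := splitsP (SchurZassenhaus_split hallLO nsLO).
have sBL : B \subset L by rewrite -defL mulG_subr.
have rhoB : rho.-group B.
  have oB : #|B| = #|A|.
    apply/eqP; rewrite -(eqn_pmul2l (cardG_gt0 (L :&: O))) -TI_cardMg // defL.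
    by rewrite -oLO Lagrange ?subsetIl.
  by rewrite (eq_pgroup _ rhoE) /pgroup oB.
have nsBL : B <| L.
  have : (L :&: O) * B \subset 'N(B); last by rewrite defL /normal sBL => ->.
  rewrite mul_subG ?normG //.
  rewrite cents_norm // centsC (subset_trans sBL) // (subset_trans cLO) //.
  by rewrite centS ?subsetIr.
have B1 : B :=: 1.
  apply/trivgP; rewrite -rho1; apply: subset_trans (pcore_max rhoB nsBL) _.
  apply: pcore_max (pcore_pgroup _ _) _.
  exact: char_normal_trans (pcore_char _ _) nsLG.
case/eqP: ntA; rewrite -defA; apply/trivgP; rewrite quotient_sub1 //.
by rewrite -defL B1 mulg1 subsetIr.
Qed.

End PSolvable.

(** * Powerful embedding *)
(** The [e] for which [p ^ e] is the exponent, 4 or [p], of powerful embedding. *)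
Definition pw_exp (p : nat) : nat := if p == 2 then 2%N else 1%N.

Lemma pow_subgroupE (gT : finGroupType) (p : nat) (N : {group gT}) :
  p.-group N -> pow_subgroup N (if p == 2 then 4 else p) = 'Mho^(pw_exp p)(N).
Proof.
by move=> pN; rewrite (MhoE _ pN) /pw_exp; case: eqP => [->|_]; rewrite ?expn1.
Qed.

Lemma mem_Mho (gT : finGroupType) (p n : nat) (N : {group gT}) x :
  p.-group N -> x \in N -> x ^+ (p ^ n) \in 'Mho^n(N).
Proof. by move=> pN Nx; rewrite Mho_p_elt ?(mem_p_elt pN). Qed.

Lemma quotient_Mho (gT : finGroupType) (n : nat) (A W : {group gT}) :
  A \subset 'N(W) -> 'Mho^n(A) / W = 'Mho^n(A / W).
Proof. exact: morphim_Mho. Qed.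

Section MhoEmbedded.
Variables (gT : finGroupType) (p : nat).
Implicit Types P N : {group gT}.

(** For [u = [~ x, g]], the commutator [[~ u, x]] is central, so [(x * u) ^+ p] is [x ^+ p * u ^+ p]
    times a power of [[~ u, x]] with exponent ['C(p, 2)]. For odd [p] this exponent is a multiple of
    [p], and elements of ['Mho^1(N)] have trivial [p]-th power. *)
Lemma Mho1_central_odd P N :
    prime p -> p != 2 -> p.-group P -> N <| P -> [~: N, P] \subset 'Mho^1(N) ->
    'Mho^1('Mho^1(N)) = 1 -> [~: 'Mho^1(N), P] \subset 'Z(P) ->
  'Mho^1(N) \subset 'C(P).
Proof.
move=> p_pr p_odd pP nsNP sNP MX sXZ; have [sNP' nNP] := andP nsNP.
have pN := pgroupS sNP' pP; have pX := pgroupS (Mho_sub 1 N) pN.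
have X_p v : v \in 'Mho^1(N) -> v ^+ p = 1.
  by move=> Xv; apply/set1P; rewrite -[[set 1]]MX -[p]expn1 mem_Mho.
rewrite (MhoE _ pN) gen_subG; apply/subsetP=> _ /imsetP[x Nx ->]; rewrite expn1.
apply/centP=> g Pg; apply/commgP/conjg_fixP.
have Px := subsetP sNP' x Nx.
have Xu : [~ x, g] \in 'Mho^1(N) by rewrite (subsetP sNP) ?mem_commg.
have Zc : [~ [~ x, g], x] \in 'Z(P) by rewrite (subsetP sXZ) ?mem_commg.
have [Pc cPc] := centerP _ _ Zc.
have Pu : [~ x, g] \in P by rewrite groupR.
have Xc : [~ [~ x, g], x] \in 'Mho^1(N).
  have nXP : P \subset 'N('Mho^1(N)) := char_norm_trans (Mho_char 1 N) nNP.
  by rewrite commgEl groupMl ?groupV // memJ_norm // (subsetP nXP).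
rewrite conjXg -[x ^ g](mulKVg x) -commgEl expMg_Rmul; try by apply: commute_sym; apply: cPc.
have [k ->] : exists k, 'C(p, 2) = (p * k)%N.
  have /dvdnP[k ->] : p %| 'C(p, 2).
    have p_gt2 : 2 < p by rewrite ltn_neqAle eq_sym p_odd prime_gt1.
    exact: prime_dvd_bin.
  by exists k; rewrite mulnC.
by rewrite expgM (X_p _ Xu) (X_p _ Xc) expg1n !mulg1.
Qed.

(** Since [[~ x ^+ 2, g]] is central, [[~ x ^+ 4, g]] is its square. This makes ['Mho^2(N)] first
    abelian, then of exponent dividing 2, then central; finally [u = [~ x, g]] lies in it, so
    [(x * u) ^+ 2 = x ^+ 2]. *)
Lemma Mho1_central_even P N :
    2.-group P -> N <| P -> [~: N, P] \subset 'Mho^2(N) ->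
    'Mho^2('Mho^1(N)) = 1 -> [~: 'Mho^1(N), P] \subset 'Z(P) ->
  'Mho^1(N) \subset 'C(P).
Proof.
move=> pP nsNP sNP MX sXZ; have [sNP' nNP] := andP nsNP.
have pN := pgroupS sNP' pP; have pX := pgroupS (Mho_sub 1 N) pN.
have PN x : x \in N -> x \in P by apply/subsetP.
have X_4 v : v \in 'Mho^1(N) -> v ^+ 4 = 1.
  by move=> Xv; apply/set1P; rewrite -[[set 1]]MX (mem_Mho 2 pX).
have X2 x : x \in N -> x ^+ 2 \in 'Mho^1(N).
  by move=> Nx; rewrite (mem_Mho 1 pN).
have cX x g h : x \in N -> g \in P -> h \in P -> commute [~ x ^+ 2, g] h.
  move=> Nx Pg Ph; have : [~ x ^+ 2, g] \in 'Z(P).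
    by rewrite (subsetP sXZ) ?mem_commg ?X2.
  by case/centerP=> _; apply.
have c2 x g : x \in N -> g \in P -> [~ x ^+ 4, g] = [~ x ^+ 2, g] ^+ 2.
  move=> Nx Pg; rewrite (expgM x 2 2) commXg //.
  exact: commute_sym (cX _ _ _ Nx Pg (groupX 2 (PN _ Nx))).
have c4 x g : x \in N -> g \in P -> [~ x ^+ 2, g] ^+ 4 = 1.
  move=> Nx Pg; rewrite -commXg ?X_4 ?X2 ?comm1g //.
  exact: commute_sym (cX _ _ _ Nx Pg (groupX 2 (PN _ Nx))).
have abM : abelian 'Mho^2(N).
  rewrite (MhoE _ pN) abelian_gen; apply/centsP=> _ /imsetP[x Nx ->] _ /imsetP[y Ny ->].
  apply/commgP; rewrite (_ : (2 ^ 2 = 4)%N) // c2 ?groupX ?PN // (expgM y 2 2) commgX.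
    by rewrite -expgM c4 ?groupX ?PN.
  exact: commute_sym (cX _ _ _ Nx (groupX 2 (PN _ Ny)) (groupX 2 (PN _ Ny))).
have M2 v : v \in 'Mho^2(N) -> v ^+ 2 = 1.
  have genM i (c : 'I_i -> gT) : (forall j, c j \in [set x ^+ (2 ^ 2)%N | x in N]) ->
      (\prod_j c j \in 'Mho^2(N)) && ((\prod_j c j) ^+ 2 == 1).
    elim: i c => [|i IH] c Xc; first by rewrite big_ord0 group1 expg1n eqxx.
    have /andP[Mt /eqP t2] := IH _ (fun j => Xc (lift ord0 j)).
    have [x Nx cx] := imsetP (Xc ord0).
    have Mx : x ^+ (2 ^ 2)%N \in 'Mho^2(N) by rewrite (mem_Mho 2 pN).
    rewrite big_ord_recl cx groupM // expgMn; last exact: (centsP abM).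
    by rewrite t2 mulg1 -expgM (expgM x 2 4) X_4 ?X2 /=.
  rewrite {1}(MhoE _ pN) => /gen_prodgP[n [c Xc ->]].
  by case/andP: (genM n c Xc) => _ /eqP.
rewrite (MhoE _ pN) gen_subG; apply/subsetP=> _ /imsetP[x Nx ->]; rewrite expn1.
apply/centP=> g Pg; apply/commgP/conjg_fixP.
have M4c y h : y \in N -> h \in P -> [~ y ^+ 4, h] = 1.
  by move=> Ny Ph; rewrite c2 // (M2 [~ y ^+ 2, h]) // (subsetP sNP) ?mem_commg ?groupX.
have cM : 'Mho^2(N) \subset 'C(P).
  rewrite (MhoE _ pN) gen_subG; apply/subsetP=> _ /imsetP[y Ny ->].
  by apply/centP=> h Ph; apply/commgP/eqP; apply: M4c.
have Mu : [~ x, g] \in 'Mho^2(N) by rewrite (subsetP sNP) ?mem_commg.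
have cxu : commute x [~ x, g] := commute_sym (centP (subsetP cM _ Mu) _ (PN _ Nx)).
by rewrite conjXg -[x ^ g](mulKVg x) -commgEl expgMn // (M2 _ Mu) mulg1.
Qed.

Lemma Mho1_central P N :
    prime p -> p.-group P -> N <| P -> [~: N, P] \subset 'Mho^(pw_exp p)(N) ->
    'Mho^(pw_exp p)('Mho^1(N)) = 1 -> [~: 'Mho^1(N), P] \subset 'Z(P) ->
  'Mho^1(N) \subset 'C(P).
Proof.
move=> p_pr pP nsNP; rewrite /pw_exp; case: eqP => [p2|/eqP p_odd].
  by rewrite p2 in pP; apply: Mho1_central_even.
exact: Mho1_central_odd.
Qed.

End MhoEmbedded.

(** Work modulo [W] and let [Q] be the commutator to be killed. In a nilpotent group it is enough
    that [Q] lies in [R = [~: Q, P / W]]; modulo [R] the group [Q] is central, which is the case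
    settled by [Mho1_central]. *)
Lemma Mho1_embedded (gT : finGroupType) (p : nat) (P N : {group gT}) :
    prime p -> p.-group P -> N <| P -> [~: N, P] \subset 'Mho^(pw_exp p)(N) ->
  [~: 'Mho^1(N), P] \subset 'Mho^(pw_exp p)('Mho^1(N)).
Proof.
move=> p_pr pP nsNP sNP; have [sNP' nNP] := andP nsNP.
pose W := 'Mho^(pw_exp p)('Mho^1(N))%G; change ([~: 'Mho^1(N), P] \subset W).
have nXP : P \subset 'N('Mho^1(N)) := char_norm_trans (Mho_char 1 N) nNP.
have sXN := Mho_sub 1 N; have sXP := subset_trans sXN sNP'.
have nWP : P \subset 'N(W) by apply: char_norm_trans nXP; apply: Mho_char.
have nWX := subset_trans sXP nWP; have nWN := subset_trans sNP' nWP.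
pose Q := [~: 'Mho^1(N) / W, P / W]%G.
have nQP : P / W \subset 'N(Q) by rewrite commg_normr.
have nXQ : 'Mho^1(N) / W \subset 'N([~: Q, P / W]).
  by rewrite (subset_trans (quotientS W sXP)) // commg_normr.
rewrite -quotient_sub1 ?comm_subG // quotientR //.
have: nilpotent (P / W) by rewrite quotient_nil ?(pgroup_nil pP).
move/forall_inP/(_ Q) => nilP; apply/trivgP/eqP/nilP.
rewrite subsetI comm_subG ?quotientS //=.
pose R := [~: Q, P / W]%G.
have nRP : P / W \subset 'N(R) by rewrite commg_normr.
have nRX := subset_trans (quotientS W sXP) nRP; have nRN := subset_trans (quotientS W sNP') nRP.
rewrite -[[~: Q, _]]/(gval R) -quotient_cents2 //.
pose N' := (N / W / R)%G; pose P' := (P / W / R)%G.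
have MhoE2 n (A : {group gT}) : A \subset 'N(W) -> A / W \subset 'N(R) ->
    'Mho^n(A) / W / R = 'Mho^n(A / W / R).
  by move=> nWA nRA; rewrite !quotient_Mho.
have X' : 'Mho^1(N) / W / R = 'Mho^1(N') by apply: MhoE2.
rewrite X'.
have pP' : p.-group P' by rewrite !quotient_pgroup.
have nsNP' : N' <| P' by rewrite !quotient_normal.
have sNP2 : [~: N', P'] \subset 'Mho^(pw_exp p)(N').
  by rewrite -MhoE2 // -!quotientR ?(subset_trans (quotientS W sNP')) // !quotientS.
have M1 : 'Mho^(pw_exp p)('Mho^1(N')) = 1.
  rewrite -X' -MhoE2 //.
  by rewrite (_ : 'Mho^(pw_exp p)('Mho^1(N)) / W = 1) ?quotient1 // trivg_quotient.
have sXZ : [~: 'Mho^1(N'), P'] \subset 'Z(P').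
  rewrite subsetI comm_subG ?(subset_trans (Mho_sub _ _) (normal_sub nsNP')) //=.
  have QE : Q / R = [~: 'Mho^1(N) / W / R, P'] by apply: quotientR.
  rewrite -X' -QE quotient_cents2 // (subset_trans _ nRP) //.
  by rewrite comm_subG ?quotientS.
exact: (Mho1_central p_pr pP' nsNP' sNP2 M1 sXZ).
Qed.

Lemma quotient_embedded (gT : finGroupType) (e : nat) (P N M : {group gT}) :
    P \subset 'N(M) -> N \subset P ->
  ([~: N / M, P / M] \subset 'Mho^e(N / M)) = ([~: N, P] \subset M * 'Mho^e(N)).
Proof.
move=> nMP sNP; have nMN := subset_trans sNP nMP.
by rewrite -quotientR // -quotient_Mho // quotientSK // comm_subG.
Qed.

(** Replace [N] by ['Mho^1(N) <*> M] as long as ['Mho^1(N)] is not inside [Q]; embedding modulo [M]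
    persists by [Mho1_embedded]. *)
Lemma last_embedded_outside (gT : finGroupType) (p : nat) (P N M Q : {group gT}) :
    prime p -> p.-group P -> N <| P -> M <| P -> M \subset N -> M \subset Q ->
    [~: N, P] \subset M * 'Mho^(pw_exp p)(N) -> ~~ (N \subset Q) ->
  exists T : {group gT}, [/\ T <| P, ~~ (T \subset Q), 'Mho^1(T) \subset Q
    & [~: T, P] \subset M * 'Mho^(pw_exp p)(T)].
Proof.
move=> p_pr pP nsNP nsMP sMN sMQ; have [n] := ubnP #|N|.
elim: n N nsNP sMN => // n IH N nsNP sMN leNn sNP sNQ.
have [sMNQ | nsMNQ] := boolP ('Mho^1(N) \subset Q); first by exists N.
have [[sMP nMP] [sNP' nNP]] := (andP nsMP, andP nsNP).
have nMN := subset_trans sNP' nMP.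
pose N1 := ('Mho^1(N) <*> M)%G.
have nsN1P : N1 <| P by rewrite normalY // (char_normal_trans (Mho_char _ _)).
have N1M : N1 / M = 'Mho^1(N / M).
  by rewrite quotientYidr ?(subset_trans (Mho_sub _ _)) // quotient_Mho.
apply: (IH N1) => //; first exact: joing_subr.
(* The order drops: otherwise [N / M] would equal its Frattini subgroup, forcing [N] into [M] and so
   into [Q]. *)
- have sN1N : N1 \subset N by rewrite join_subG Mho_sub.
  rewrite -ltnS; apply: leq_trans leNn; rewrite ltnS; apply: proper_card; rewrite properEneq sN1N andbT.
  apply: contra sNQ => /eqP eN1; apply: subset_trans sMQ.
  rewrite -quotient_sub1 // subG1.
  have pNM : p.-group (N / M) by rewrite quotient_pgroup ?(pgroupS sNP').
  apply: contraT => ntNM; have := Phi_proper ntNM.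
  by rewrite properE (Phi_joing pNM) -N1M eN1 joing_subr andbF.
- rewrite -quotient_embedded ?(normal_sub nsN1P) // N1M.
  by rewrite Mho1_embedded ?quotient_pgroup ?quotient_normal // quotient_embedded.
by apply: contra nsMNQ; apply: subset_trans; apply: joing_subl.
Qed.

(** * The terms of an eta-series inside the p-core *)
(** Collecting powers of [y] to the left applies [1 + y + ... + y^(p-1)] to [u]; in characteristic
    [p] this operator is [(y - 1)^(p-1)]. *)
Lemma expgM_iter_comm (gT : finGroupType) (p : nat) (U : {group gT}) (y u : gT) :
    prime p -> p.-abelem U -> y \in 'N(U) -> u \in U ->
  (y * u) ^+ p \in y ^+ p *: iter_comm <[y]> p.-1 U.
Proof.
move=> p_pr abU nUy Uu; rewrite mem_lcoset.
have [U1|ntU] := eqsVneq U 1.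
  by move: Uu; rewrite U1 => /set1P->; rewrite mulg1 mulVg (group1 (iter_comm_gp _ _ 1%G)).
have nUY : <[y]> \subset 'N(U) by rewrite cycle_subG.
set rG := abelem_repr abU ntU nUY; set v := abelem_rV abU ntU u.
have Yy := cycle_id y.
have powE k : (y * u) ^+ k
    = y ^+ k * rVabelem abU ntU (v *m (\sum_(i < k) rG y ^+ i)%R).
  elim: k => [|k IH]; first by rewrite big_ord0 mulmx0 rVabelem0 mulg1.
  rewrite big_ord_recl GRing.expr0 mulmxDr mulmx1 rVabelemD abelem_rV_K //.
  rewrite expgSr {}IH -mulgA (mulgA _ y u) (conjgC _ y) -(rVabelemJ abU ntU nUY) //.
  rewrite (expgSr y) -!mulgA; congr (_ * (_ * _)).
  rewrite -mulmxA (centsP (abelem_abelian abU) u) ?mem_rVabelem //; congr (rVabelem _ _ (v *m _) * u).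
  by rewrite mulmx_suml; apply: eq_bigr => i _; rewrite -[LHS]GRing.exprSr.
rewrite powE mulKg sum_expr_mx ?inE ?p_pr ?pchar_Fp_0 //.
exact: rVabelem_iter_comm.
Qed.

(** Frattini argument: [K :^ g] is again a complement to [Q] in [H], so it is conjugate to [K] under
    [Q]. *)
Lemma Frattini_complement (gT : finGroupType) (G H Q K : {group gT}) (g : gT) :
    Q <| G -> H <| G -> solvable Q -> K \in [complements to Q in H] ->
    coprime #|Q| #|K| -> g \in G ->
  exists2 x, x \in Q & g * x \in 'N(K).
Proof.
move=> nsQG nsHG solQ /complP[tiQK defH] coQK Gg.
have sKH : K \subset H by rewrite -defH mulG_subr.
have nQK : K \subset 'N(Q).
  exact: subset_trans (subset_trans sKH (normal_sub nsHG)) (normal_norm nsQG).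
have [||x Qx Kg] := SchurZassenhaus_trans_sol (K1 := (K :^ g)%G) solQ nQK _ coQK.
- by rewrite defH -(normsP (normal_norm nsHG) g Gg) conjSg.
- by rewrite cardJg.
exists x^-1; rewrite ?groupV // inE /= conjsgM; have /= -> := Kg.
by rewrite conjsgK.
Qed.

(** Here [M] is the preceding term of the series, and [j] counts the commutators with [P] that push
    it into ['Phi('O_p(G))]. *)
Lemma embedded_sub_pcore (gT : finGroupType) (p : nat) (G P M T : {group gT}) (j : nat) :
    prime p -> 2 < p -> p_solvable p G -> 'O_p^'(G) = 1 -> p.-Sylow(G) P ->
    M <| P -> M \subset 'O_p(G) -> T <| P -> 'Mho^1(T) \subset 'O_p(G) ->
    [~: T, P] \subset M * 'Mho^1(T) -> iter_comm P j M \subset 'Phi('O_p(G)) ->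
    j.+1 <= p.-2 ->
  T \subset 'O_p(G).
Proof.
move=> p_pr p_gt2 solG p'G1 sylP nsMP sMQ nsTP sXQ sTPM iterM lejp.
pose Q := 'O_p(G)%G; change (T \subset Q).
have {}sMQ : M \subset Q := sMQ; have {}sXQ : 'Mho^1(T) \subset Q := sXQ.
have {}iterM : iter_comm P j M \subset 'Phi(Q) := iterM.
have pQ : p.-group Q := pcore_pgroup _ _.
have nsQG : Q <| G := pcore_normal _ _; have [sQG nQG] := andP nsQG.
have sQP : Q \subset P := pcore_sub_Hall sylP.
have sPG := pHall_sub sylP; have pP := pHall_pgroup sylP.
have sTP := normal_sub nsTP; have sTG := subset_trans sTP sPG.
have sMP := normal_sub nsMP.
have cQ : 'C_G(Q) \subset Q by apply: (cent_sub_pcore (p := p) (rho := p^')); auto.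
pose H := 'O_{p, p^'}(G)%G.
have nsHG : H <| G := pseries_normal _ _.
have HQ : H / Q = 'O_p^'(G / Q) by apply: quotient_pseries2.
have sQH : Q \subset H by rewrite /= -pseries1; apply: (pseries_sub_catl [:: p : nat_pred] [:: p^']).
have nsQH : Q <| H := normalS sQH (normal_sub nsHG) nsQG.
have p'HQ : p^'.-group (H / Q) by rewrite HQ pcore_pgroup.
have hallQ : Hall H Q.
  by rewrite /Hall sQH -card_quotient ?normal_norm // (pnat_coprime pQ).
have [K complK] := splitsP (SchurZassenhaus_split hallQ nsQH).
have [tiQK defH] := complP complK.
have sKH : K \subset H by rewrite -defH mulG_subr.
have sKG := subset_trans sKH (normal_sub nsHG).
have nQK := subset_trans sKG nQG.
have KQ : K / Q = H / Q by rewrite -defH quotientMidl.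
have p'K : p^'.-group K.
  have cardK : #|K| = #|H / Q| by rewrite -KQ; apply: card_isog (quotient_isog nQK tiQK).
  by rewrite /pgroup cardK.
have coQK : coprime #|Q| #|K| := pnat_coprime pQ p'K.
have solQ := pgroup_sol pQ.
have FratQ g : g \in G -> exists2 x, x \in Q & g * x \in 'N(K).
  exact: Frattini_complement nsQG nsHG solQ complK coQK.
pose R := ('C_Q(K) <*> 'Phi(Q))%G.
have sFR : 'Phi(Q) \subset R := joing_subr _ _.
have sRQ : R \subset Q by rewrite join_subG subsetIl Phi_sub.
(* [Q] normalises [R], which contains its derived group; up to a factor in [Q], every element of [G]
   normalises [K] and hence [R]. *)
have nRG : G \subset 'N(R).
  have nRQ : Q \subset 'N(R).
    apply: sub_der1_norm sRQ; apply: subset_trans sFR.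
    by rewrite (Phi_joing pQ) joing_subl.
  apply/subsetP=> g Gg; have [x Qx Kgx] := FratQ g Gg.
  rewrite -(mulgK x g) groupMr ?groupV; last exact: subsetP nRQ x Qx.
  have nQgx : g * x \in 'N(Q) by rewrite (subsetP nQG) // groupM // (subsetP sQG).
  have nQ' : <[g * x]> \subset 'N(Q) by rewrite cycle_subG.
  have nK' : <[g * x]> \subset 'N(K) by rewrite cycle_subG.
  suff: <[g * x]> \subset 'N(R) by rewrite cycle_subG.
  by apply: normsY; rewrite ?normsI ?norms_cent // (char_norm_trans (Phi_char Q)).
have nRP := subset_trans sPG nRG; have nRT := subset_trans sTP nRP.
have nRQ := subset_trans sQG nRG; have nRK := subset_trans sKG nRG.
have nRM := subset_trans sMP nRP.
pose U := (Q / R)%G.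
have pU : p.-group U by rewrite quotient_pgroup.
have abU : p.-abelem U.
  rewrite -(trivg_Phi pU) -(quotient_Phi pQ) //; apply/eqP.
  by apply/trivgP; rewrite quotient_sub1 // (subset_trans (Phi_sub Q)).
pose Y := (T / R <*> U)%G.
have nUP : P / R \subset 'N(U) by rewrite quotient_norms // (subset_trans sPG).
have sYP : Y \subset P / R by rewrite join_subG !quotientS.
have nUY := subset_trans sYP nUP.
have sUY : U \subset Y := joing_subr _ _.
(* The [p]-th power of [y * u] lies in [Q] and normalises [K]; its commutators with [K] lie in
   [Q :&: K = 1], so it belongs to ['C_Q(K)] and dies modulo [R]. *)
have liftT y : y \in T -> exists2 u, u \in Q &
    [/\ y * u \in 'N(K), coset R (y * u) \in Y & coset R (y * u) ^+ p = 1].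
  move=> Ty; have Gy := subsetP sTG y Ty; have [u Qu Nyu] := FratQ y Gy; exists u => //.
  have Gyu : y * u \in G by rewrite groupM // (subsetP sQG).
  have nRyu := subsetP nRG _ Gyu; split=> //.
    rewrite morphM ?(subsetP nRT y) ?(subsetP nRQ u) // groupM //.
      by rewrite mem_gen // inE mem_quotient.
    by rewrite (subsetP sUY) // mem_quotient.
  have Qyup : (y * u) ^+ p \in Q.
    have Ny := subsetP nQG y Gy; have Nu := subsetP nQG u (subsetP sQG u Qu).
    have Qyp : y ^+ p \in Q by rewrite (subsetP sXQ) // -[p]expn1 mem_Mho // (pgroupS sTP).
    apply: coset_idr; rewrite ?groupX ?groupM // morphX ?groupM //= morphM //=.
    by rewrite (coset_id Qu) mulg1 -morphX //= coset_id.
  suff : (y * u) ^+ p \in R by move/coset_id; rewrite morphX.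
  rewrite mem_gen // inE; apply/orP; left; rewrite inE Qyup /=.
  have : <[(y * u) ^+ p]> \subset 'C(K).
    apply/commG1P/trivgP; apply: subset_trans (_ : _ \subset Q :&: K) _; last by rewrite tiQK.
    rewrite subsetI; apply/andP; split.
      apply: subset_trans (_ : [~: Q, K] \subset Q); first by rewrite commSg // cycle_subG.
      by rewrite commg_subl.
    by rewrite commg_subr cycle_subG groupX.
  by rewrite cycle_subG.
have pX : 'Mho^1(T) / R \subset iter_comm Y p.-1 U.
  rewrite quotient_Mho // (MhoE _ (quotient_pgroup _ (pgroupS sTP pP))) gen_subG.
  apply/subsetP=> _ /imsetP[_ /morphimP[y Ny Ty ->] ->]; rewrite expn1.
  have [u Qu [Nyu Yyu yup]] := liftT y Ty.
  have Nu := subsetP nRQ u Qu; have Uu : coset R u \in U by rewrite mem_quotient.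
  have Yy : coset R y \in Y by rewrite mem_gen // inE mem_quotient.
  have := expgM_iter_comm p_pr abU (subsetP nUY _ Yy) Uu.
  rewrite -(morphM _ Ny Nu) /= yup mem_lcoset mulg1 groupV.
  by apply: (subsetP (iter_commS _ _ (subxx _))); rewrite cycle_subG.
have cUU : abelian U := abelem_abelian abU.
(* [U] is abelian, so only [T] contributes; the eta-condition and [pX] bound the result. *)
have sUY1 : [~: U, Y] \subset M / R * iter_comm Y p.-1 U.
  have -> : [~: U, Y] = [~: T / R, U].
    have YE : Y :=: T / R * U by rewrite [LHS]norm_joinEl // (subset_trans (quotientS R sTP)).
    by rewrite commGC YE commMG ?commg_normr // [[~: U, U]](commG1P cUU) mulg1.
  rewrite -quotientR //.
  apply: subset_trans (quotientS R (subset_trans (commgS T sQP) sTPM)) _.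
  by rewrite quotientMl // mulgS.
have nYUn n : Y \subset 'N(iter_comm Y n U) := iter_comm_norm n (normG Y) nUY.
have sUn n : iter_comm Y n U \subset Y := subset_trans (iter_comm_sub n nUY) sUY.
have Mj : iter_comm Y j (M / R) = 1.
  apply/trivgP; apply: subset_trans (iter_commS j sYP (subxx _)) _.
  rewrite -quotient_iter_comm ?(normal_norm nsMP) //.
  apply: subset_trans (quotientS R iterM) _.
  by rewrite quotient_sub1 // (subset_trans (Phi_sub Q)).
have Uj : iter_comm Y j.+1 U \subset iter_comm Y (j + p.-1) U.
  rewrite iter_commSr iter_commD.
  apply: subset_trans (iter_commS j (subxx _) sUY1) _.
  have nMY : Y \subset 'N(M / R) by rewrite (subset_trans sYP) // quotient_norms // normal_norm.
  apply: subset_trans (iter_comm_mul j nMY (nYUn p.-1) (sUn p.-1)) _.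
  by rewrite /= Mj mul1g.
(* [Uj] gives [U_(j+1) <= U_(j+2)], which is impossible in a nilpotent group unless trivial *)
have U1 : iter_comm Y j.+1 U = 1.
  have nilY : nilpotent Y by rewrite (nilpotentS sYP) // quotient_nil // (pgroup_nil pP).
  apply/eqP; move/forall_inP: nilY => /(_ (iter_comm_gp j.+1 Y U)); apply.
  rewrite subsetI sUn andTb; change (iter_comm Y j.+1 U \subset iter_comm Y j.+2 U).
  apply: subset_trans Uj _.
  (* As [p > 2], at least [j + 2] commutators are available. *)
  have -> : j + p.-1 = p.-1.-2 + j.+2.
    by case: (p) p_gt2 => [|[|[|q]]] //= _; rewrite !addnS addnC.
  by rewrite iter_commD; apply: iter_comm_sub (nYUn j.+2).
have Up2 : iter_comm Y p.-2 U = 1.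
  have := iter_commD (p.-2 - j.+1) j.+1 Y U; rewrite subnK // U1 => ->; apply/trivgP.
  by apply: (iter_comm_sub _ (W := 1%G)); rewrite norms1.
(* For [l = y * u], the group [A = [~: K, <[l]>]] centralises [Q / R] by [quadratic_comm_cent], and
   [R / 'Phi(Q)] because [A] lies in [K]. Hence it centralises [Q], lies in [Q :&: K] and is
   trivial; [l] and [y] agree modulo [Q]. *)
have cTH : T / Q \subset 'C(H / Q).
  apply/subsetP=> _ /morphimP[y Ny Ty ->].
  have [u Qu [Nyu Yyu yup]] := liftT y Ty.
  set l := y * u in Nyu Yyu yup.
  have [Gy Gu] : y \in G /\ u \in G by rewrite (subsetP sTG) ?(subsetP sQG).
  have Gl : l \in G by rewrite groupM.
  have Nl := subsetP nQG l Gl; have NRl := subsetP nRG l Gl.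
  pose A := [~: K, <[l]>]%G.
  have sAK : A \subset K by rewrite commg_subl cycle_subG.
  have nRA := subset_trans sAK nRK; have nQA := subset_trans sAK nQK.
  have p'A : p^'.-group A := pgroupS sAK p'K.
  have cAU : A / R \subset 'C(U).
    rewrite quotientR ?cycle_subG // quotient_cycle //.
    apply: (quadratic_comm_cent p_pr pU) => //; rewrite ?quotient_pgroup //.
    - by rewrite -cycle_subG -quotient_cycle // quotient_norms // cycle_subG.
    - by rewrite -cycle_subG -quotient_cycle // quotient_norms // cycle_subG.
    - by rewrite quotient_norms.
    by apply/trivgP; rewrite -Up2 iter_commS // cycle_subG.
  have cAQ : A \subset 'C(Q).
    apply: (coprime_cent_Phi pQ nQA (pnat_coprime pQ p'A)).
    have nFQ := normal_norm (Phi_normal Q).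
    have nFA : A \subset 'N('Phi(Q)) := char_norm_trans (Phi_char Q) nQA.
    have pQF : p.-group (Q / 'Phi(Q)) by rewrite quotient_pgroup.
    rewrite commGC -quotient_cents2 //.
    apply: (coprime_cent_stable (H := (R / 'Phi(Q))%G)); rewrite ?quotient_norms ?(pgroup_sol pQF) //.
    - by rewrite quotient_normal // /normal sRQ.
    - rewrite /R /= quotientYidr ?(subset_trans (subsetIl _ _)) // quotient_cents //.
      by rewrite centsC (subset_trans (subsetIr _ _)) // centS.
    - by rewrite -quotientR // quotientS // commGC -quotient_cents2.
    exact: pnat_coprime pQF (quotient_pgroup _ p'A).
  have A1 : A :=: 1.
    apply/trivgP; apply: subset_trans (_ : _ \subset Q :&: K) _; last by rewrite tiQK.
    by rewrite subsetI sAK (subset_trans _ cQ) // subsetI cAQ (subset_trans sAK).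
  have cKl : <[l]> \subset 'C(K) by rewrite centsC; apply/commG1P.
  have cosetl : coset Q l = coset Q y.
    by rewrite morphM ?(subsetP nQG) //= (coset_id Qu) mulg1.
  have : coset Q l \in 'C(K / Q).
    by rewrite (subsetP (quotient_cents Q cKl)) // mem_quotient // cycle_id.
  by rewrite cosetl KQ.
have TQ1 : T / Q = 1.
  apply/trivgP; rewrite -(coprime_TIg (_ : coprime #|T / Q| #|H / Q|)); last first.
    exact: pnat_coprime (quotient_pgroup _ (pgroupS sTP pP)) p'HQ.
  rewrite subsetI subxx /= HQ.
  apply: subset_trans (_ : 'C_(G / Q)('O_p^'(G / Q)) \subset _).
    by rewrite subsetI quotientS //= -HQ.
  apply: (cent_sub_pcore (p := p) (rho := p)); [by right | exact: quotient_p_solvable|].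
  exact: trivg_pcore_quotient.
by rewrite -quotient_sub1 ?TQ1 // (subset_trans sTG).
Qed.

(** [D], the centraliser of [Q / 'Phi(Q)] in [G], is normal. An element of [D] of prime order other
    than [p] would centralise [Q], hence lie in [Q]; so [D] is a p-group. This handles [p = 2]. *)
Lemma sub_Phi_cent_pcore (gT : finGroupType) (p : nat) (G T : {group gT}) :
    p_solvable p G -> 'O_p^'(G) = 1 -> T \subset G ->
    [~: 'O_p(G), T] \subset 'Phi('O_p(G)) ->
  T \subset 'O_p(G).
Proof.
move=> solG p'G1 sTG; pose Q := 'O_p(G)%G; change ([~: Q, T] \subset 'Phi(Q) -> T \subset Q).
have pQ : p.-group Q := pcore_pgroup _ _.
have nsQG : Q <| G := pcore_normal _ _; have nQG := normal_norm nsQG.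
have nFG : G \subset 'N('Phi(Q)) := char_norm_trans (Phi_char Q) nQG.
have nFQ := normal_norm (Phi_normal Q).
have cQ : 'C_G(Q) \subset Q by apply: (cent_sub_pcore (p := p) (rho := p^')); auto.
pose D := (G :&: coset 'Phi(Q) @*^-1 'C(Q / 'Phi(Q)))%G => sQT.
have nsDG : D <| G.
  rewrite /normal subsetIl normsI ?normG //.
  apply: subset_trans (morphpre_norm _ _); rewrite -sub_quotient_pre //.
  by rewrite norms_cent // quotient_norms.
have sTD : T \subset D.
  have nFT := subset_trans sTG nFG.
  by rewrite subsetI sTG -sub_quotient_pre // quotient_cents2 // commGC.
apply: subset_trans sTD _; apply: pcore_max nsDG.
apply/pgroupP=> q q_pr /(Cauchy q_pr)[x Dx oxq]; apply: contraT => p'q.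
have Gx : x \in G by case/setIP: Dx.
have p'x : p^'.-group <[x]> by rewrite /pgroup -orderE oxq pnatE.
have nQx : <[x]> \subset 'N(Q) by rewrite cycle_subG (subsetP nQG).
have cxQ : <[x]> \subset 'C(Q).
  apply: (coprime_cent_Phi pQ) => //; first exact: pnat_coprime pQ p'x.
  have nFx : <[x]> \subset 'N('Phi(Q)) by rewrite cycle_subG (subsetP nFG).
  rewrite commGC -quotient_cents2 // sub_quotient_pre // cycle_subG.
  by case/setIP: Dx.
have Qx : x \in Q by rewrite (subsetP cQ) // inE Gx -cycle_subG.
by have := mem_p_elt pQ Qx; rewrite /p_elt oxq pnatE // (negPf p'q).
Qed.

(** The eta-condition on [B / A] pulled back to [P], so that all terms are compared in one group. *)
Definition eta_step (gT : finGroupType) (p : nat) (P : {set gT}) (A B : {group gT}) : bool :=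
  [&& A \subset B, B <| P & [~: B, P] \subset A * 'Mho^(pw_exp p)(B)].

(* Number of steps of an eta-series absorbed by one [p]-layer: [p - 2], but [1] for [p = 2]. *)
Definition eta_bound (p : nat) : nat := maxn p.-2 1.

Lemma Mho_sub_Phi (gT : finGroupType) (p e : nat) (Q : {group gT}) :
  p.-group Q -> 0 < e -> 'Mho^e(Q) \subset 'Phi(Q).
Proof.
move=> pQ e_gt0; rewrite (Phi_joing pQ); apply: subset_trans (joing_subr _ _).
exact: Mho_leq.
Qed.

Lemma pw_exp_gt0 p : 0 < pw_exp p. Proof. by rewrite /pw_exp; case: ifP. Qed.

(** Each term [B] found inside the core [Q] raises [j] by one: [[~: B, P]] lies in
    [A * 'Mho^(pw_exp p)(B)], whose second factor is in ['Phi(Q)]. *)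
Lemma eta_path_sub_pcore (gT : finGroupType) (p : nat) (G P A : {group gT}) (s : seq {group gT}) j :
    prime p -> p_solvable p G -> 'O_p^'(G) = 1 -> p.-Sylow(G) P ->
    A <| P -> A \subset 'O_p(G) -> iter_comm P j A \subset 'Phi('O_p(G)) ->
    path (eta_step p P) A s -> j + size s <= eta_bound p ->
  last A s \subset 'O_p(G).
Proof.
move=> p_pr solG p'G1 sylP; have pP := pHall_pgroup sylP; have sPG := pHall_sub sylP.
have pQ : p.-group 'O_p(G) := pcore_pgroup _ _.
elim: s A j => [|B s IH] A j //= nsAP sAQ iterA /andP[/and3P[sAB nsBP sBP] path_s] lejd.
have nAP := normal_norm nsAP; have [sBP' nBP] := andP nsBP; have pB := pgroupS sBP' pP.
have sBQ : B \subset 'O_p(G).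
  apply: contraT => nsBQ.
  have [T [nsTP nsTQ sXQ sTP]] := last_embedded_outside p_pr pP nsBP nsAP sAB sAQ sBP nsBQ.
  have sTP' := normal_sub nsTP; have pT := pgroupS sTP' pP.
  case/negP: nsTQ; have [p2 | p_neq2] := eqVneq p 2.
    (* A single step is allowed, so [A] itself is in ['Phi(Q)]. Fourth powers from [T] are squares
       of elements of ['Mho^1(T)], hence of [Q]. *)
    have j0 : j = 0%N by move: lejd; rewrite /eta_bound p2 addnS; case: (j).
    apply: sub_Phi_cent_pcore => //; first exact: subset_trans sPG.
    rewrite commGC; apply: subset_trans (commgS T (pcore_sub_Hall sylP)) _.
    apply: subset_trans sTP _; rewrite mul_subG //; first by rewrite j0 in iterA.
    apply: subset_trans (Mho_sub_Phi pQ (ltn0Sn 0)).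
    subst p; change ('Mho^2(T) \subset 'Mho^1('O_2(G))); rewrite (MhoE 2 pT) gen_subG.
    apply/subsetP=> _ /imsetP[x Tx ->]; rewrite (expgM x 2 2) (mem_Mho 1 pQ) //.
    by rewrite (subsetP sXQ) // (mem_Mho 1 pT).
  have p_gt2 : 2 < p by rewrite ltn_neqAle eq_sym p_neq2 prime_gt1.
  have e1 : pw_exp p = 1%N by rewrite /pw_exp (negPf p_neq2).
  rewrite e1 in sTP.
  apply: (embedded_sub_pcore p_pr p_gt2 solG p'G1 sylP nsAP sAQ nsTP sXQ sTP iterA).
  move: lejd; rewrite /eta_bound (maxn_idPl _); last by case: (p) p_gt2 => [|[|[|]]].
  by apply: leq_trans; rewrite addnS ltnS leq_addr.
apply: (IH B j.+1) => //; last by rewrite addSnnS.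
rewrite iter_commSr; apply: subset_trans (iter_commS j (subxx P) sBP) _.
have nMP : P \subset 'N('Mho^(pw_exp p)(B)) := char_norm_trans (Mho_char _ _) nBP.
have sMP : 'Mho^(pw_exp p)(B) \subset P := subset_trans (Mho_sub _ _) sBP'.
apply: subset_trans (iter_comm_mul j nAP nMP sMP) _.
rewrite mul_subG //; apply: subset_trans (iter_comm_sub j nMP) _.
exact: subset_trans (MhoS _ sBQ) (Mho_sub_Phi pQ (pw_exp_gt0 p)).
Qed.

(** * Quotients of eta-series and induction over the p-layers *)

Lemma eta_step_quotient (gT : finGroupType) (p : nat) (P N A B : {group gT}) :
    P \subset 'N(N) -> A \subset P -> eta_step p P A B ->
  eta_step p (P / N) (A / N)%G (B / N)%G.
Proof.
move=> nNP sAP /and3P[sAB nsBP sBP]; have sBP' := normal_sub nsBP.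
rewrite /eta_step /= quotientS // quotient_normal //= -quotientR ?(subset_trans sBP') //.
rewrite -quotient_Mho ?(subset_trans sBP') // -quotientMl ?quotientS //.
exact: subset_trans nNP.
Qed.

Lemma eta_path_quotient (gT : finGroupType) (p : nat) (P N A : {group gT}) s :
    P \subset 'N(N) -> A \subset P -> path (eta_step p P) A s ->
  path (eta_step p (P / N)) (A / N)%G [seq (B / N)%G | B : {group gT} <- s].
Proof.
move=> nNP; elim: s A => //= B s IH A sAP /andP[stepAB path_s].
rewrite eta_step_quotient // IH //.
by case/and3P: stepAB => _ /andP[].
Qed.

Lemma eta_path_pseries (p n : nat) : prime p ->
  forall (gT : finGroupType) (G P : {group gT}) (s : seq {group gT}),
    p_solvable p G -> p.-Sylow(G) P -> path (eta_step p P) 1%G s ->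
    last 1%G s :=: P -> size s <= n * eta_bound p ->
  pseries (pseq p n) G = G.
Proof.
move=> p_pr; elim: n => [|n IH] gT G P s solG sylP path_s last_s size_s.
  have P1 : P :=: 1 by move: size_s last_s; rewrite mul0n leqn0 => /nilP->.
  have /= -> := pseries1 p^' G; apply: pcore_pgroup_id.
  have := card_Hall sylP; rewrite P1 cards1 => /esym/eqP.
  by rewrite p_part_eq1 /pgroup p'natE // inE /= mem_primes p_pr cardG_gt0.
have pP := pHall_pgroup sylP; have sPG := pHall_sub sylP.
pose N0 := 'O_p^'(G)%G; pose B := 'O_{p^', p}(G)%G.
have nsN0G : N0 <| G := pcore_normal _ _; have nsBG : B <| G := pseries_normal _ _.
have nN0P := subset_trans sPG (normal_norm nsN0G).
have nBP := subset_trans sPG (normal_norm nsBG).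
pose s1 := take (eta_bound p) s; pose s2 := drop (eta_bound p) s.
have sE : s = s1 ++ s2 by rewrite cat_take_drop.
pose A := last 1%G s1.
have [path_s1 path_s2] : path (eta_step p P) 1%G s1 /\ path (eta_step p P) A s2.
  by apply/andP; rewrite -cat_path -sE.
have sAP : A \subset P.
  rewrite /A; case/lastP: (s1) path_s1 => [|s' C]; first by rewrite sub1G.
  by rewrite last_rcons rcons_path => /andP[_ /and3P[_ /andP[]]].
(* Modulo ['O_p^'(G)] the first [eta_bound p] terms fall into the p-core, starting from the trivial
   group with [j = 0]. *)
have sAB : A \subset B.
  have sN0B : N0 \subset B by rewrite /= -pseries1; apply: (pseries_sub_catl [:: p^'] [:: p : nat_pred]).
  rewrite -(quotientSGK (subset_trans sAP nN0P) sN0B) /= quotient_pseries2.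
  have pathN0 := eta_path_quotient nN0P (sub1G P) path_s1.
  rewrite (_ : A / N0 = last (1 / N0)%G [seq (C / N0)%G | C : {group gT} <- s1]); last by rewrite last_map.
  apply: (eta_path_sub_pcore (P := (P / N0)%G) (j := 0)) pathN0 _ => //=.
  - exact: quotient_p_solvable (normal_norm nsN0G) solG.
  - exact: trivg_pcore_quotient.
  - exact: quotient_pHall.
  - by rewrite quotient1 normal1.
  - by rewrite quotient1 sub1G.
  - by rewrite quotient1 sub1G.
  by rewrite size_map size_take_min geq_minl.
have BA : (A / B)%G = 1%G by apply/val_inj/trivgP; rewrite quotient_sub1 // (subset_trans sAP).
(* The first terms vanish in [P / B], so the tail [s2] yields an eta-series from 1. *)
have GB : pseries (pseq p n) (G / B) = G / B.
  apply: (IH _ _ (P / B)%G [seq (C / B)%G | C : {group gT} <- s2]).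
  - exact: quotient_p_solvable (normal_norm nsBG) solG.
  - exact: quotient_pHall.
  - by rewrite -BA eta_path_quotient.
  - by rewrite -BA last_map -last_cat -sE /= last_s.
  by rewrite size_map size_drop leq_subLR -mulSn.
have sub_pc : pseries (pseq p n.+1) G \subset G := pseries_sub _ _.
have := quotient_pseries_cat [:: p^'; p : nat_pred] (pseq p n) G.
rewrite [RHS]GB => /(quotient_inj (H := B)) eqG.
apply: eqG => //; apply: normalS sub_pc nsBG.
exact: (pseries_sub_catl [:: p^'; p : nat_pred] (pseq p n)).
Qed.

(** * p-length *)
Lemma eta_path_of_series (gT : finGroupType) (p : nat) (P : {group gT}) (s : seq {group gT}) :
  p.-group P -> eta_series p P s -> path (eta_step p P) 1%G s.
Proof.
rewrite /eta_series => pP; have : (1%G : {group gT}) <| P := normal1 P.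
elim: s (1%G : {group gT}) => //= B s IH A nsAP /andP[/and3P[sAB nsBP /andP[_ sBP]] path_s].
have sBP' := normal_sub nsBP.
rewrite IH // andbT /eta_step sAB nsBP /= -quotient_embedded ?normal_norm //.
by rewrite -pow_subgroupE // quotient_pgroup ?(pgroupS sBP').
Qed.

(** Central sections are powerfully embedded, so the upper central series is an eta-series; it
    ensures that the search defining [pwc] succeeds. *)
Lemma eta_reaches_ucn (gT : finGroupType) (p n : nat) (P : {group gT}) :
  nilpotent P -> nil_class P <= n -> eta_reaches p P P n.
Proof.
move=> nilP nP; pose s := mkseq (fun i => 'Z_i.+1(P)%G) n.
have sz : size s == n by rewrite size_mkseq.
have nthZ i : i <= n -> nth 1%G (1%G :: s) i = 'Z_i(P)%G.
  by case: i => [_|i lt_i]; [apply/val_inj; rewrite /= ucn0 | rewrite /= nth_mkseq].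
apply/existsP; exists (Tuple sz); apply/andP; split; last first.
  rewrite (last_nth 1%G) /= nthZ ?size_mkseq //=.
  exact/eqP/ucn_nil_classP.
apply/(pathP 1%G) => i; rewrite size_mkseq => lt_in.
rewrite nthZ 1?ltnW // nth_mkseq //= ucn_subS ucn_normal /=.
rewrite /pw_embedded quotient_normal ?ucn_normal //=.
suff /commG1P-> : 'Z_i.+1(P) / 'Z_i(P) \subset 'C(P / 'Z_i(P)) by rewrite sub1set group1.
by rewrite ucn_central subsetIr.
Qed.

Lemma pwc_eta_path (gT : finGroupType) (p : nat) (P : {group gT}) : p.-group P ->
  exists s : seq {group gT},
    [/\ path (eta_step p P) 1%G s, last 1%G s :=: P & size s = pwc p P].
Proof.
move=> pP; have nilP := pgroup_nil pP.
have hasP : has (eta_reaches p P P) (iota 0 #|P|.+1).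
  apply/hasP; exists (nil_class P); last exact: eta_reaches_ucn.
  (* This places the witness in the searched range, so [find] does not return its default. *)
  have lt_nP : nil_class P < #|P| by rewrite -nilpotent_class.
  by rewrite mem_iota /= add0n ltnS ltnW.
have := nth_find 0 hasP; rewrite has_find size_iota in hasP.
rewrite nth_iota // add0n -/(pwc p P) => /existsP[s /andP[eta_s /eqP last_s]].
by exists s; rewrite size_tuple; split=> //; apply: eta_path_of_series.
Qed.

Lemma p_length_le (gT : finGroupType) (p n : nat) (G : {group gT}) :
  pseries (pseq p n) G = G -> p_length p G <= n.
Proof.
move=> Gn; rewrite leqNgt; apply/negP => lt_n; have := before_find 0 lt_n.
(* [find] never exceeds the length of the range, so an [n] below it is in range. *)
by rewrite nth_iota ?add0n ?Gn ?eqxx // -[X in _ < X](size_iota 0) (leq_trans lt_n) ?find_size.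
Qed.

Theorem theorem1p2 (gT : finGroupType) (p : nat) (G P : {group gT}) :
  prime p -> p_solvable p G -> (p.-Sylow(G) P)%g ->
  (2 < p -> p_length p G <= (pwc p P + (p - 3)) %/ (p - 2)) /\
  (p = 2 -> p_length p G <= pwc p P).
Proof.
move=> p_pr solG sylP.
have [s [path_s last_s size_s]] := pwc_eta_path (pHall_pgroup sylP).
have p_length_bound n : pwc p P <= n * eta_bound p -> p_length p G <= n.
  by rewrite -size_s => /(eta_path_pseries p_pr solG sylP path_s last_s)/p_length_le.
split=> [p_gt2 | p2]; apply: p_length_bound; last by rewrite /eta_bound p2 muln1.
have p2_gt0 : 0 < p - 2 by rewrite subn_gt0.
have p3 : p - 2 = (p - 3).+1 by rewrite -subSn.
(* The ceiling of [c / d] is [(c + (d - 1)) %/ d], with [d = p - 2]. *)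
rewrite /eta_bound -subn2 (maxn_idPl p2_gt0) -ltnS -(ltn_add2r (p - 3)) addSn.
by rewrite [_ * _ + _]addnC -(addSn (p - 3)) -p3 -mulSn ltn_ceil.
Qed.
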